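(* Let $G$ be a maximally edge-connected graph of order $m\geq 3$, and let $n\geq 4$. If $$\min\{\,n^2\delta(G),\ (n-1)(m+2e(G))\,\}\geq 3n\delta(G)+3n-9,$$ then $G\boxtimes K_n$ is maximally 3-restricted edge-connected.
   Context: Graphs are finite and simple. The order of $G$ is $|V(G)|$, $e(G)=|E(G)|$, and $\delta(G)$ is the minimum degree of $G$. $K_n$ is the complete graph of order $n$. An edge subset $S\subseteq E(G)$ is an edge-cut if $G-S$ is disconnected; the edge-connectivity $\lambda(G)$ is the minimum cardinality of an edge-cut. $G$ is maximally edge-connected if $\lambda(G)=\delta(G)$. An edge subset $S\subseteq E(G)$ is a 3-restricted edge-cut if $G-S$ is disconnected and each component of $G-S$ has at least three vertices. $\lambda_3(G)$ is the minimum cardinality of a 3-restricted edge-cut of $G$ if one exists, and $\lambda_3(G)=+\infty$ otherwise. For $X\subseteq V(G)$, $\partial_G(X)$ is the set of edges with one endpoint in $X$ and the other in $V(G)\setminus X$, and $\xi_3(G)=\min\{|\partial_G(X)| : X\subseteq V(G),\ |X|=3,\ G[X]\text{ is connected}\}$. $G$ is maximally 3-restricted edge-connected if $\lambda_3(G)=\xi_3(G)$. The strong product $G\boxtimes H$ has vertex set $V(G)\times V(H)$; two distinct vertices $(x_1,y_1)$, $(x_2,y_2)$ are adjacent iff $x_1=x_2$ and $y_1y_2\in E(H)$, or $y_1=y_2$ and $x_1x_2\in E(G)$, or $x_1x_2\in E(G)$ and $y_1y_2\in E(H)$. *)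

(* Defs.v *)
From HB Require Import structures.
From mathcomp Require Import all_boot.

Set Implicit Arguments.
Unset Strict Implicit.
Unset Printing Implicit Defensive.

Record sgraph := SGraph {
  svertex :> finType;
  sedge : rel svertex;
  sedge_sym : symmetric sedge;
  sedge_irrefl : irreflexive sedge
}.

Notation "x -- y" := (sedge x y) (at level 30).

(* An edge xy is represented by the unordered pair [set x; y]. *)
Definition edges (G : sgraph) : {set {set G}} :=
  [set [set p.1; p.2] | p : G * G & p.1 -- p.2].

Definition degree (G : sgraph) (x : G) : nat := #|[set y | x -- y]|.

(* Every degree is at most #|G|, so the default value of the minimum only
   matters for the graph without vertices. *)
Definition min_degree (G : sgraph) : nat :=
  \big[minn/#|G|]_(x : G) degree x.

Section DeleteEdges.
Variables (G : sgraph) (S : {set {set G}}).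

Definition del_rel : rel G := [rel x y | (x -- y) && ([set x; y] \notin S)].

Lemma del_rel_sym : symmetric del_rel.
Proof. by move=> x y; rewrite /del_rel /= sedge_sym setUC. Qed.

Lemma del_rel_irrefl : irreflexive del_rel.
Proof. by move=> x; rewrite /del_rel /= sedge_irrefl. Qed.

Definition del_edges : sgraph := SGraph del_rel_sym del_rel_irrefl.

End DeleteEdges.

Section Induced.
Variables (G : sgraph) (X : {set G}).

Definition induced_rel : rel {x : G | x \in X} :=
  [rel u v | val u -- val v].

Lemma induced_rel_sym : symmetric induced_rel.
Proof. by move=> u v; rewrite /induced_rel /= sedge_sym. Qed.

Lemma induced_rel_irrefl : irreflexive induced_rel.
Proof. by move=> u; rewrite /induced_rel /= sedge_irrefl. Qed.

Definition induced : sgraph := SGraph induced_rel_sym induced_rel_irrefl.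

End Induced.

Definition component (G : sgraph) (x : G) : {set G} :=
  [set y | connect (@sedge G) x y].

Definition components (G : sgraph) : {set {set G}} :=
  [set component x | x : G].

Definition connected (G : sgraph) : bool :=
  [forall x : G, forall y : G, connect (@sedge G) x y].

Definition edge_cut (G : sgraph) (S : {set {set G}}) : bool :=
  (S \subset edges G) && ~~ connected (del_edges S).

(* If G has at least two vertices then edges G is an edge-cut, and no edge-cut
   is larger, so this is the minimum cardinality of an edge-cut.  If G has at
   most one vertex there is no edge-cut and the value is 0. *)
Definition edge_connectivity (G : sgraph) : nat :=
  \big[minn/#|edges G|]_(S : {set {set G}} | edge_cut S) #|S|.

Definition maximally_edge_connected (G : sgraph) : Prop :=
  edge_connectivity G = min_degree G.

Definition restricted3_edge_cut (G : sgraph) (S : {set {set G}}) : bool :=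
  edge_cut S && [forall C in components (del_edges S), 3 <= #|C|].

(* Minimum of F over the indices satisfying P; None stands for +oo and is the
   value when no index satisfies P. *)
Definition min_opt (I : finType) (P : pred I) (F : I -> nat) : option nat :=
  if [pick i | P i] is Some i0 then Some (F [arg min_(i < i0 | P i) F i])
  else None.

Definition lambda3 (G : sgraph) : option nat :=
  min_opt (@restricted3_edge_cut G) (fun S => #|S|).

Definition edge_boundary (G : sgraph) (X : {set G}) : {set {set G}} :=
  [set [set x; y] | x in X, y in ~: X & x -- y].

Definition xi3 (G : sgraph) : option nat :=
  min_opt [pred X : {set G} | (#|X| == 3) && connected (induced X)]
          (fun X => #|edge_boundary X|).

Definition maximally_3restricted_edge_connected (G : sgraph) : Prop :=
  lambda3 G = xi3 G.

Section StrongProduct.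
Variables G H : sgraph.

Definition strong_rel : rel (G * H) :=
  [rel p q | (p != q) &&
     [|| (p.1 == q.1) && (p.2 -- q.2),
         (p.2 == q.2) && (p.1 -- q.1)
       | (p.1 -- q.1) && (p.2 -- q.2)]].

Lemma strong_rel_sym : symmetric strong_rel.
Proof.
move=> p q; rewrite /strong_rel /= eq_sym (eq_sym p.1) (eq_sym p.2).
by rewrite (sedge_sym p.1) (sedge_sym p.2).
Qed.

Lemma strong_rel_irrefl : irreflexive strong_rel.
Proof. by move=> p; rewrite /strong_rel /= eqxx. Qed.

Definition strong_product : sgraph := SGraph strong_rel_sym strong_rel_irrefl.

End StrongProduct.

Section Complete.
Variable n : nat.

Definition complete_rel : rel 'I_n := [rel i j | i != j].

Lemma complete_rel_sym : symmetric complete_rel.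
Proof. by move=> i j; rewrite /complete_rel /= eq_sym. Qed.

Lemma complete_rel_irrefl : irreflexive complete_rel.
Proof. by move=> i; rewrite /complete_rel /= eqxx. Qed.

Definition complete_graph : sgraph :=
  SGraph complete_rel_sym complete_rel_irrefl.

End Complete.

(* Main.v *)
Require Import Defs.
From HB Require Import structures.
From mathcomp Require Import all_boot zify.

Set Implicit Arguments.
Unset Strict Implicit.
Unset Printing Implicit Defensive.

(* For a vertex set X of the product with fibre counts a_x, the boundary has
   size  sum over closed-adjacent ordered pairs (x, y) of  a_x (n - a_y),  an
   expression invariant under complementing X.  Put d = delta(G).  Three
   vertices in the fibre over a vertex of degree d give the value
   3nd + 3n - 9, and every X with |X|, |V - X| >= 3 reaches it:
   - if one fibre is full and another empty, each of the n level sets of a is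
     a proper cut of G, which gives n^2 d;
   - if all fibres are partial, a_x (n - a_y) + a_y (n - a_x) >= 2(n - 1), so
     the sum is at least (n - 1)(m + 2 e(G));
   - otherwise, up to complement, some fibre is empty and none is full; if
     some a_x = t >= 3, its t levels and the edges inside the fibre of x give
     n t d + t (n - t), and if a <= 2 a degree count suffices. *)

(** * Minima over finite families *)

Lemma bigmin_leq_seq (I : eqType) (r : seq I) (P : pred I) (F : I -> nat) d i :
  i \in r -> P i -> \big[minn/d]_(j <- r | P j) F j <= F i.
Proof.
elim: r => // j r IHr; rewrite inE big_cons => /orP[/eqP <- -> | ri Pi].
  exact: geq_minl.
by case: (P j); rewrite ?geq_min IHr ?orbT.
Qed.

Lemma bigmin_leq (I : finType) (P : pred I) (F : I -> nat) d i :
  P i -> \big[minn/d]_(j | P j) F j <= F i.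
Proof. by apply: bigmin_leq_seq; rewrite mem_index_enum. Qed.

Lemma min_opt_eq (I : finType) (P : pred I) (F : I -> nat) i :
  P i -> (forall j, P j -> F i <= F j) -> min_opt P F = Some (F i).
Proof.
move=> Pi Fi; rewrite /min_opt; case: pickP => [i0 Pi0|/(_ i)]; last by rewrite Pi.
case: arg_minnP => // j Pj Fj.
by congr Some; apply/eqP; rewrite eqn_leq Fj // Fi.
Qed.

(** * Degrees, edge boundaries and edge-cuts *)

Section Graph.
Variable G : sgraph.
Implicit Types (x y : G) (X : {set G}) (S : {set {set G}}).

(** Distinct vertices of the product with a complete graph are adjacent exactly when this relation
    holds between their first coordinates. *)
Definition cadj : rel G := [rel x y | (x == y) || x -- y].

Lemma cadj_sym : symmetric cadj.
Proof. by move=> x y; rewrite /cadj /= eq_sym sedge_sym. Qed.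

Lemma sum_cadj (F : G -> nat) x :
  \sum_(y | cadj x y) F y = F x + \sum_(y | x -- y) F y.
Proof.
rewrite (bigD1 x) /=; last by rewrite /cadj /= eqxx.
congr (_ + _); apply: eq_bigl => y.
by rewrite /cadj /= eq_sym; case: eqVneq => [<-|_] /=; rewrite ?andbT ?sedge_irrefl.
Qed.

Lemma card_cadj x : \sum_(y | cadj x y) 1 = (degree x).+1.
Proof. by rewrite sum_cadj add1n sum1dep_card. Qed.

Lemma min_degree_leq x : min_degree G <= degree x.
Proof. exact: bigmin_leq. Qed.

Lemma degree_ltn x : degree x < #|G|.
Proof.
rewrite -cardsT; apply: proper_card; rewrite properEneq subsetT andbT.
by apply/eqP=> /setP/(_ x); rewrite !inE sedge_irrefl.
Qed.

Lemma min_degree_attained : 0 < #|G| -> exists x, degree x = min_degree G.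
Proof.
move=> /card_gt0P[x0 _].
(* Every degree is below [#|G|], which rules out the default value of the minimum. *)
suff [E|//] : min_degree G = #|G| \/ exists x, degree x = min_degree G.
  by have := min_degree_leq x0; rewrite E leqNgt degree_ltn.
rewrite /min_degree; elim/big_ind: _ => [|a b IHa IHb|x _]; [by left| |by right; exists x].
by case: (leqP a b).
Qed.

(** Exactly one end of a boundary edge lies in [X], so the unordered edge determines its
    orientation. *)
Lemma card_edge_boundary X :
  #|edge_boundary X| = \sum_(x in X) \sum_(y in ~: X | x -- y) 1.
Proof.
rewrite pair_big_dep sum1dep_card /=.
have -> : edge_boundary X = [set [set p.1; p.2] | p in
    [set p : G * G | [&& p.1 \in X, p.2 \in ~: X & p.1 -- p.2]]].
  apply/setP=> e; apply/imset2P/imsetP.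
    case=> x y Xx; rewrite inE => /andP[Yy xy] ->.
    by exists (x, y); rewrite // inE Xx Yy.
  case=> -[x y]; rewrite inE => /and3P[/= Xx Yy xy] ->.
  by exists x y; rewrite // inE Yy.
rewrite card_in_imset // => -[x y] [x' y']; rewrite !inE /=.
move=> /and3P[Xx Yy _] /and3P[Xx' Yy' _] /setP E.
have := E x; rewrite !inE eqxx /= => /esym/orP[/eqP Ex|/eqP Ex]; last by rewrite -Ex Xx in Yy'.
have := E y; rewrite !inE eqxx orbT /= => /esym/orP[/eqP Ey|/eqP Ey]; last by rewrite Ex Ey.
by rewrite Ey Xx' in Yy.
Qed.

Lemma edge_boundary_edges X : edge_boundary X \subset edges G.
Proof.
apply/subsetP=> e /imset2P[x y _]; rewrite inE => /andP[_ xy] ->.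
by apply/imsetP; exists (x, y); rewrite ?inE.
Qed.

Lemma boundary_edge_cut X : X != set0 -> X != setT -> edge_cut (edge_boundary X).
Proof.
move=> /set0Pn[x Xx] XT; have /subsetPn[y _ Xy] : ~~ (setT \subset X) by rewrite subTset.
rewrite /edge_cut edge_boundary_edges /=; apply/negP=> /forallP/(_ x)/forallP/(_ y) cxy.
have clX : closed (@sedge (del_edges (edge_boundary X))) X.
  apply: intro_closed => [|u v]; first exact/sym_connect_sym/sedge_sym.
  move=> /andP[uv Suv] Xu; apply: contraNT Suv => Xv.
  by apply/imset2P; exists u v; rewrite // !inE Xv.
by rewrite (closed_connect clX cxy) (negPf Xy) in Xx.
Qed.

Lemma edge_connectivity_leq X : X != set0 -> X != setT ->
  edge_connectivity G <= #|edge_boundary X|.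
Proof. by move=> X0 XT; apply: bigmin_leq; apply: boundary_edge_cut. Qed.

(** Take for [X] one component left by deleting [S]; a second one lies in its complement. Lower
    bounds on boundaries thus become lower bounds on [lambda3]. *)
Lemma restricted3_cut_boundary S : restricted3_edge_cut S ->
  exists X, [/\ 3 <= #|X|, 3 <= #|~: X| & edge_boundary X \subset S].
Proof.
move=> /andP[/andP[_ nconn] /forallP big];
have [x /forallPn[y nxy]] := forallPn nconn.
have cbig z : 3 <= #|component (z : del_edges S)|.
  by have /implyP := big (component (z : del_edges S)); apply; apply: imset_f.
have symc : connect_sym (@sedge (del_edges S)) by exact/sym_connect_sym/sedge_sym.
exists (component (x : del_edges S)); split; first exact: cbig.
  apply: leq_trans (cbig y) (subset_leq_card _); apply/subsetP=> z; rewrite !inE => cyz.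
  by apply: contra nxy => cxz; apply: connect_trans cxz _; rewrite symc.
apply/subsetP=> e /imset2P[u v]; rewrite !inE => cxu /andP[ncxv uv] ->.
apply: contraNT ncxv => Suv; apply: connect_trans cxu (connect1 _).
by rewrite /= /del_rel /= uv.
Qed.

(** Over each edge lie the two ordered pairs [(x, y)] and [(y, x)], distinct by irreflexivity. *)
Lemma handshake_leq : 2 * #|edges G| <= \sum_(x : G) degree x.
Proof.
rewrite [leqRHS](_ : _ = #|[set p : G * G | p.1 -- p.2]|); last first.
  rewrite -sum1dep_card -(pair_big_dep xpredT (fun x y => x -- y) (fun _ _ => 1)) /=.
  by apply: eq_bigr => x _; rewrite sum1dep_card.
rewrite -[leqRHS]sum1_card (partition_big (fun p => [set p.1; p.2]) (mem (edges G))) /=; last first.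
  by move=> p; rewrite inE => pE; apply/imsetP; exists p; rewrite ?inE.
rewrite mulnC -sum_nat_const; apply: leq_sum => e /imsetP[[x y] /= xy ->].
rewrite inE /= in xy.
rewrite sum1dep_card (_ : 2 = #|[set (x, y); (y, x)]|).
  apply: subset_leq_card; apply/subsetP=> p.
  by rewrite !inE => /orP[] /eqP -> /=; rewrite ?xy ?eqxx // sedge_sym xy setUC eqxx.
rewrite cards2 xpair_eqE; case: eqVneq xy => //= ->.
by rewrite sedge_irrefl.
Qed.

End Graph.

(** * Cut sizes in terms of fibre counts *)

Section WeightedCut.
Variables (G : sgraph) (n : nat).
Implicit Types (x y : G) (a : G -> nat).

Definition weighted_cut a := \sum_x \sum_(y | cadj x y) a x * (n - a y).

Lemma sum_relC (r : rel G) (F : G -> G -> nat) : symmetric r ->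
  \sum_x \sum_(y | r x y) F x y = \sum_x \sum_(y | r x y) F y x.
Proof.
move=> symr; rewrite (exchange_big_dep xpredT) //=; apply: eq_bigr => x _.
by apply: eq_bigl => y; rewrite symr.
Qed.

Lemma weighted_cutC a : (forall x, a x <= n) ->
  weighted_cut (fun x => n - a x) = weighted_cut a.
Proof.
move=> an; rewrite /weighted_cut [RHS](sum_relC _ (@cadj_sym G)); apply: eq_bigr => x _.
by apply: eq_bigr => y _; rewrite subKn // mulnC.
Qed.

Lemma weighted_cutD a :
  2 * weighted_cut a =
  \sum_x \sum_(y | cadj x y) (a x * (n - a y) + a y * (n - a x)).
Proof.
rewrite mul2n -addnn {2}/weighted_cut (sum_relC _ (@cadj_sym G)) -big_split; apply: eq_bigr => x _.
by rewrite -big_split.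
Qed.

Lemma weighted_cut_proper a : (forall x, 0 < a x < n) ->
  (n - 1) * (#|G| + 2 * #|edges G|) <= weighted_cut a.
Proof.
move=> a_proper; rewrite -(leq_pmul2l (isT : 0 < 2)) weighted_cutD.
apply: (@leq_trans (\sum_x \sum_(y | cadj x y) 2 * (n - 1))); last first.
  apply: leq_sum => x _; apply: leq_sum => y _.
  (* The expression is affine in each of [b] and [c], so its minimum is at a corner of the square
     from [1] to [n - 1]: either [2(n - 1)] or [1 + (n - 1)^2], whose difference is [(n - 2)^2]. *)
  have := a_proper x; have := a_proper y; move: (a x) (a y) => b c.
  by move=> /andP[c0 cn] /andP[b0 bn]; nia.
rewrite mulnA; under eq_bigr => x _ do
  rewrite -[2 * (n - 1)]muln1 -big_distrr card_cadj.
rewrite -big_distrr /= leq_mul2l; apply/orP; right.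
under eq_bigr => x _ do rewrite -addn1.
by rewrite big_split /= sum1_card addnC leq_add2r handshake_leq.
Qed.

(** A closed neighbourhood has at least [min_degree G + 1] vertices, and each leaves at least
    [n - k] free places. This serves large total weights. *)
Lemma weighted_cut_thin k a : (forall x, a x <= k) ->
  (\sum_x a x) * ((n - k) * (min_degree G).+1) <= weighted_cut a.
Proof.
move=> ak; rewrite big_distrl; apply: leq_sum => x _ /=.
rewrite -big_distrr /= leq_mul2l; apply/orP; right.
apply: (@leq_trans (\sum_(y | cadj x y) (n - k))).
  by rewrite -[n - k in leqRHS]muln1 -big_distrr card_cadj leq_mul2l ltnS min_degree_leq orbT.
by apply: leq_sum => y _; rewrite leq_sub2l.
Qed.

(** The fibres over a closed neighbourhood offer at least [n (min_degree G + 1)] places, and the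
    weights fill at most their total of them. At total weight 3 this is exactly the extremal
    value. *)
Lemma weighted_cut_small a : (forall x, a x <= n) ->
  (\sum_x a x) * (n * (min_degree G).+1 - \sum_x a x) <= weighted_cut a.
Proof.
move=> an; rewrite big_distrl; apply: leq_sum => x _ /=.
rewrite -big_distrr /= leq_mul2l; apply/orP; right.
rewrite leq_subLR; apply: (@leq_trans (\sum_(y | cadj x y) n)).
  by rewrite -[n in leqRHS]muln1 -big_distrr card_cadj leq_mul2l ltnS min_degree_leq orbT.
rewrite [in leqRHS](bigID (cadj x)) /= addnAC -big_split /=.
by apply: leq_trans (leq_addr _ _); apply: leq_sum => y _; rewrite subnKC.
Qed.

(* The levels [{x | t < a x}] with [t < a x1] are proper cuts of [G]; each
   counts [n] times because [b (n - c) + c (n - b) >= n |b - c|]. *)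
Lemma weighted_cut_levels a x0 x1 : (forall x, a x <= n) -> a x0 = 0 ->
  a x1 * (n - a x1) + n * (a x1 * edge_connectivity G) <= weighted_cut a.
Proof.
move=> an a0.
have split_diag : weighted_cut a = \sum_x a x * (n - a x) +
    \sum_x \sum_(y | x -- y) a x * (n - a y).
  by rewrite -big_split; apply: eq_bigr => x _; rewrite sum_cadj.
rewrite split_diag leq_add //; first by rewrite (bigD1 x1) //= leq_addr.
have swap F := sum_relC F (@sedge_sym G).
apply: (@leq_trans (n * \sum_x \sum_(y | x -- y) (a x - a y))); last first.
  rewrite -(leq_pmul2l (isT : 0 < 2)) !mul2n -!addnn.
  rewrite -mulnDr {2}swap [X in _ <= _ + X]swap -!big_split big_distrr /=.
  apply: leq_sum => x _; rewrite -!big_split big_distrr /=.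
  apply: leq_sum => y _; have := an x; have := an y; move: (a x) (a y) => b c.
  by case: (leqP b c); nia.
rewrite leq_mul2l; apply/orP; right.
(* Layer-cake formula: the truncated difference counts the thresholds that separate [a y] from
   [a x]. *)
have levels x y : a x - a y = \sum_(t < n) ((a y <= t) && (t < a x)).
  rewrite -(big_mkord xpredT (fun t => nat_of_bool ((a y <= t) && (t < a x)))).
  rewrite -big_mkcond /=.
  have -> : \sum_(0 <= t < n | (a y <= t) && (t < a x)) 1 = \sum_(a y <= t < a x) 1.
    rewrite [RHS](big_nat_widen _ _ n) //= [RHS](big_nat_widenl _ 0) //=.
    by apply: eq_bigl => t; rewrite andbC.
  by rewrite sum_nat_const_nat muln1.
under [leqRHS]eq_bigr => x _ do (under eq_bigr => y _ do rewrite levels; rewrite exchange_big).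
rewrite exchange_big /=.
rewrite (bigID (fun t : 'I_n => t < a x1)) /=; apply: leq_trans (leq_addr _ _).
apply: (@leq_trans (\sum_(t < n | t < a x1) edge_connectivity G)).
  rewrite sum_nat_const leq_mul2r; apply/orP; right.
  rewrite -sum1_card -(big_ord_widen _ (fun=> 1)) //.
  by rewrite sum1_card card_ord.
apply: leq_sum => t t_lt.
apply: leq_trans (@edge_connectivity_leq G [set x | t < a x] _ _) _.
- by apply/set0Pn; exists x1; rewrite inE.
- by apply/eqP=> /setP/(_ x0); rewrite !inE a0.
rewrite card_edge_boundary big_mkcond; apply: leq_sum => x _ /=.
rewrite inE; case: ifP => // _; rewrite big_mkcond [leqRHS]big_mkcond.
by apply: leq_sum => y _; rewrite !inE -leqNgt andbT; case: (x -- y); case: (a y <= t).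
Qed.

Lemma weighted_cut_bound a : 4 <= n ->
  maximally_edge_connected G -> (forall x, a x <= n) ->
  3 <= \sum_x a x -> 3 <= \sum_x (n - a x) ->
  3 * n * min_degree G + 3 * n - 9 <=
    minn (n ^ 2 * min_degree G) ((n - 1) * (#|G| + 2 * #|edges G|)) ->
  3 * n * min_degree G + 3 * n - 9 <= weighted_cut a.
Proof.
move=> n4 Gmax; set d := min_degree G; set xi := 3 * n * d + 3 * n - 9 => + + + Hmin.
have [Hd Hm] : xi <= n ^ 2 * d /\ xi <= (n - 1) * (#|G| + 2 * #|edges G|).
  by move: Hmin; rewrite leq_min => /andP[].
(* For [d = 0] the hypothesis would read [3n - 9 <= 0], against [n >= 4]. *)
have d0 : 0 < d by rewrite lt0n; apply/negP=> /eqP E; move: Hd; rewrite /xi E; lia.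
(* Used below both for [a] and for its complement [n - a]. *)
have one_sided b : (forall x, b x < n) -> (exists x, b x = 0) ->
    3 <= \sum_x b x -> xi <= weighted_cut b.
  move=> bn [x0 b0] s3; have bn' x : b x <= n by exact: ltnW.
  have [/forallP b2 | /forallPn[x]] := boolP [forall x, b x <= 2].
    have := weighted_cut_small bn'; have := weighted_cut_thin b2.
    rewrite -/d /xi; move: (\sum_x b x) s3 => s s3 Hthin Hsmall.
    (* From [s = 6] on the thin bound suffices, since [6(n - 2) >= 3n]. *)
    have [s6|s6] := leqP 6 s.
      apply: leq_trans Hthin; apply: leq_trans (leq_mul s6 (leqnn _)).
      by rewrite -{1 2}(subnK n4) -{3}(subnK n4); move: (n - 4) => v; nia.
    (* With [N = n(d + 1) >= 8], the gap [s(N - s) - 3(N - 3)] equals [(s - 3)(N - s - 3)], which is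
       nonnegative for these [s]. *)
    apply: leq_trans Hsmall; have {s3 s6} : s = 3 \/ s = 4 \/ s = 5 by lia.
    by case=> [->|[->|->]]; nia.
  rewrite -ltnNge => bx; apply: leq_trans (weighted_cut_levels x bn' b0).
  rewrite Gmax -/d /xi; have := bn x; move: (b x) bx => t.
  case: t => [|[|[|u]]] // _ un.
  have [v ->] : exists v, n = u + 4 + v by exists (n - (u + 4)); lia.
  (* With [b x = u + 3] and [n = u + 4 + v], the goal reduces to [u n d + u v >= 2u]. *)
  have : u * 2 <= u * ((u + 4 + v) * d) by rewrite leq_mul2l; apply/orP; right; nia.
  rewrite -mulnA (mulnCA _ u.+3) (_ : u + 4 + v - u.+3 = v.+1); last by lia.
  by move: (_ * d) => w; nia.
move=> an s3 s3'.
have [/existsP[x0 /eqP a0]|/existsPn a_pos] := boolP [exists x, a x == 0].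
  have [/existsP[x1 /eqP a1]|/existsPn a_lt] := boolP [exists x, a x == n].
    apply: leq_trans (weighted_cut_levels x1 an a0).
    by rewrite a1 Gmax -/d; lia.
  apply: one_sided => // [x|]; last by exists x0.
  by rewrite ltn_neqAle a_lt an.
have [/existsP[x1 /eqP a1]|/existsPn a_lt] := boolP [exists x, a x == n].
  rewrite -weighted_cutC //; apply: one_sided => // [x|].
    by have := a_pos x; lia.
  by exists x1; rewrite a1 subnn.
apply: leq_trans Hm (weighted_cut_proper _) => x.
by rewrite lt0n a_pos ltn_neqAle a_lt an.
Qed.

End WeightedCut.

(** * Boundaries in the product with a complete graph *)

Section StrongProductComplete.
Variables (G : sgraph) (n : nat).
Local Notation P := (strong_product G (complete_graph n)).
Implicit Types (p q : P) (X : {set P}).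

Lemma strong_completeE p q : (p -- q) = (p != q) && cadj p.1 q.1.
Proof.
case: p q => [x i] [y j]; rewrite /= /strong_rel /cadj /= /complete_rel /= xpair_eqE.
by case: (eqVneq x y) => [<-|_] /=; case: (eqVneq i j) => //= _; rewrite ?andbT ?andbF ?orbF ?sedge_irrefl.
Qed.

Lemma sum_strong (F : P -> nat) : \sum_p F p = \sum_x \sum_(i < n) F (x, i).
Proof. by rewrite pair_big; apply: eq_bigr => -[]. Qed.

Definition fibre_card X (x : G) : nat := \sum_(i < n) ((x, i) \in X).

Lemma sum_fibre_card X : \sum_x fibre_card X x = #|X|.
Proof.
rewrite -sum1_card [RHS]big_mkcond sum_strong; apply: eq_bigr => x _.
by apply: eq_bigr => i _; case: (_ \in X).
Qed.

Lemma fibre_card_leq X x : fibre_card X x <= n.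
Proof.
rewrite -[leqRHS]card_ord -sum1_card; apply: leq_sum => i _.
exact: leq_b1.
Qed.

Lemma fibre_cardC X x : fibre_card (~: X) x = n - fibre_card X x.
Proof.
rewrite -(addnK (fibre_card X x) (fibre_card (~: X) x)); congr (_ - _).
rewrite -big_split /= -[RHS]card_ord -sum1_card; apply: eq_bigr => i _.
by rewrite inE; case: (_ \in X).
Qed.

(** A vertex in [X] and one outside are distinct, so they are adjacent as soon as their first
    coordinates are closed-adjacent. *)
Lemma card_edge_boundary_strong X :
  #|edge_boundary X| = weighted_cut n (fibre_card X).
Proof.
rewrite card_edge_boundary /weighted_cut.
transitivity (\sum_p \sum_q (p \in X) * ((q \in ~: X) * cadj p.1 q.1)).
  rewrite big_mkcond; apply: eq_bigr => p _.
  rewrite big_mkcond; case: ifPn => Xp; last by rewrite big1.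
  apply: eq_bigr => q _; rewrite strong_completeE inE mul1n.
  by case: eqVneq => [<-|_] /=; rewrite ?Xp // mulnb; case: ifP.
rewrite sum_strong; apply: eq_bigr => x _.
rewrite exchange_big sum_strong /=.
rewrite [RHS]big_mkcond; apply: eq_bigr => y _ /=.
rewrite -fibre_cardC big_distrlr exchange_big /=.
case: ifP => _; last by rewrite !big1 // => *; rewrite big1 // => *; rewrite !muln0.
by apply: eq_bigr => j _; apply: eq_bigr => i _; rewrite muln1.
Qed.

End StrongProductComplete.

(** * One triple attains both minima *)

Theorem corollary3p1 (G : sgraph) (m n : nat)
  (Gm : #|G| = m) (m_ge3 : 3 <= m) (n_ge4 : 4 <= n)
  (Gmax : maximally_edge_connected G)
  (Hmin : minn (n ^ 2 * min_degree G) ((n - 1) * (m + 2 * #|edges G|))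
            >= 3 * n * min_degree G + 3 * n - 9) :
  maximally_3restricted_edge_connected (strong_product G (complete_graph n)).
Proof.
subst m; set P := strong_product _ _; set d := min_degree G.
have [x0 dx0] : exists x : G, degree x = d by exact: min_degree_attained (ltnW (ltnW m_ge3)).
have d0 : 0 < d by rewrite lt0n; apply/negP=> /eqP E; move: Hmin; rewrite -/d E leq_min; lia.
have [y0 xy0] : exists y, x0 -- y.
  by move: d0; rewrite -dx0 => /card_gt0P[y]; rewrite inE; exists y.
have xy0_neq : x0 != y0 by apply: contraTneq xy0 => <-; rewrite sedge_irrefl.
pose X : {set P} := [set p : G * 'I_n | (p.1 == x0) && (p.2 < 3)].
have fX x : fibre_card X x = if x == x0 then 3 else 0.
  rewrite /fibre_card; case: eqP => [->|/eqP/negPf nx]; last first.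
    by rewrite big1 // => i _; rewrite inE /= nx.
  under eq_bigr => i _ do rewrite inE /= eqxx /=.
  rewrite -big_mkcond /= -(big_ord_widen _ (fun=> 1)); last by lia.
  by rewrite sum1_card card_ord.
have cardX : #|X| = 3.
  by rewrite -sum_fibre_card (eq_bigr _ (fun x _ => fX x)) -big_mkcond big_pred1_eq.
(* Only the row of [x0] contributes: [3(n - 3)] inside its fibre and [3n] towards each of the [d]
   neighbouring fibres. *)
have bdX : #|edge_boundary X| = 3 * n * d + 3 * n - 9.
  rewrite card_edge_boundary_strong /weighted_cut (bigD1 x0) //= [X in _ + X]big1 ?addn0; last first.
    by move=> x nx; rewrite big1 // => y _; rewrite fX (negPf nx).
  rewrite (bigD1 x0) /=; last by rewrite /cadj /= eqxx.
  rewrite (eq_bigr (fun=> 3 * n)); last first.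
    by move=> y /andP[_ ny]; rewrite !fX eqxx (negPf ny) subn0.
  have := card_cadj x0; rewrite (bigD1 x0) /=; last by rewrite /cadj /= eqxx.
  rewrite dx0 add1n => -[Ed].
  rewrite -[3 * n in X in _ + X]muln1 -big_distrr /= Ed fX eqxx; nia.
have bound (Y : {set P}) : 3 <= #|Y| -> 3 <= #|~: Y| -> #|edge_boundary X| <= #|edge_boundary Y|.
  move=> Y3 Y3'; rewrite bdX card_edge_boundary_strong; apply: weighted_cut_bound => //.
  - exact: fibre_card_leq.
  - by rewrite sum_fibre_card.
  - by under eq_bigr => x _ do rewrite -fibre_cardC; rewrite sum_fibre_card.
have fibre_subC y : y != x0 -> [set (y, i) | i : 'I_n] \subset ~: X.
  by move=> ny; apply/subsetP=> _ /imsetP[i _ ->]; rewrite !inE /= (negPf ny).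
have card_fibre (y : G) : #|[set (y, i) | i : 'I_n]| = n.
  by rewrite card_imset ?card_ord // => i j [].
have cardCX : 4 <= #|~: X|.
  by apply: leq_trans (subset_leq_card (fibre_subC y0 _)); rewrite ?card_fibre // eq_sym.
have xi3E : xi3 P = Some #|edge_boundary X|.
  apply: min_opt_eq => [|Y /andP[/eqP Y3 _]].
    rewrite /= cardX eqxx; apply/forallP=> -[p Xp]; apply/forallP=> -[q Xq].
    have [E|npq] := eqVneq p q.
      by case: q / E Xq => Xq; rewrite (bool_irrelevance Xp Xq); exact: connect0.
    apply: connect1; change (is_true ((p : P) -- q)); rewrite strong_completeE npq /cadj /=.
    by move: Xp Xq {npq}; rewrite !inE => /andP[/eqP -> _] /andP[/eqP -> _]; rewrite eqxx.
  (* The complement of any triple is as large as that of [X]. *)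
  by apply: bound; rewrite ?Y3 //; have := cardsC Y; rewrite Y3 -(cardsC X) cardX; lia.
have lambda3E : lambda3 P = Some #|edge_boundary X|.
  apply: min_opt_eq => [|S /restricted3_cut_boundary[Y [Y3 Y3' YS]]]; last first.
    exact: leq_trans (bound Y Y3 Y3') (subset_leq_card YS).
  apply/andP; split.
    apply: boundary_edge_cut; first by rewrite -card_gt0 cardX.
    by apply/eqP=> XT; move: cardCX; rewrite XT setCT cards0.
  apply/forallP=> C; apply/implyP=> /imsetP[p _ ->].
  (* Deleting the boundary keeps every edge with both ends on the same side of [X]. *)
  have step q r : (q \in X) = (r \in X) -> cadj q.1 r.1 ->
      connect (@sedge (del_edges (edge_boundary X))) q r.
    move=> Xqr qr; have [->|nqr] := eqVneq q r; first exact: connect0.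
    apply: connect1; apply/andP; split; first by rewrite strong_completeE nqr.
    apply/imset2P=> -[u v Xu]; rewrite inE => /andP[Xv _] E.
    have [uE vE] : (u \in [set q; r]) /\ (v \in [set q; r]) by rewrite E !inE !eqxx orbT.
    have XE z : z \in [set q; r] -> (z \in X) = (q \in X).
      by case/set2P=> ->.
    by move: Xv; rewrite in_setC (XE v vE) -(XE u uE) Xu.
  have [Xp|Xp] := boolP (p \in X).
    rewrite -cardX; apply/subset_leq_card/subsetP=> q Xq; rewrite inE; apply: step.
      by rewrite Xp Xq.
    by move: Xp Xq; rewrite !inE => /andP[/eqP -> _] /andP[/eqP -> _]; rewrite /cadj /= eqxx.
  (* Outside [X], the component of [p] contains a whole fibre: its own, or that of [y0] when [p]
     lies over [x0]. *)
  have [y ny py] : exists2 y, y != x0 & cadj p.1 y.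
    have [E|npx] := eqVneq p.1 x0; last by exists p.1; rewrite // /cadj /= eqxx.
    by exists y0; rewrite 1?eq_sym // /cadj /= E xy0 orbT.
  have n3 : 3 <= n by lia.
  apply: leq_trans n3 _; rewrite -(card_fibre y); apply/subset_leq_card/subsetP=> q.
  move=> qF; rewrite inE; apply: step.
    have := subsetP (fibre_subC y ny) q qF; rewrite in_setC => /negPf ->.
    by rewrite (negPf Xp).
  by case/imsetP: qF => i _ ->.
by rewrite /maximally_3restricted_edge_connected lambda3E xi3E.
Qed.
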